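(* Let $p$ be a prime, $\mathbb{F}_q$ a finite field of characteristic $p$, $n\ge1$, $s_1,\dots,s_n$ positive integers, and $N_1,\dots,N_n$ integers with $0\le N_j\le p^{s_j}$. Let $$C=\langle (x_1-1)^{N_1}\cdots(x_n-1)^{N_n}\rangle\subset\mathcal{R}=\frac{\mathbb{F}_q[x_1,\dots,x_n]}{\langle x_1^{p^{s_1}}-1,\dots,x_n^{p^{s_n}}-1\rangle}.$$ Then $$C^{\perp}=\langle (x_1-1)^{p^{s_1}-N_1},\dots,(x_n-1)^{p^{s_n}-N_n}\rangle$$ as ideals of $\mathcal{R}$.
   Context: Each element of $\mathcal{R}$ is identified with its unique representative $f=\sum f_{(a_1,\dots,a_n)}x_1^{a_1}\cdots x_n^{a_n}$ with $0\le a_j<p^{s_j}$, hence with the vector of its coefficients in $\mathbb{F}_q^{p^{s_1}\cdots p^{s_n}}$. $C^\perp$ is the dual code of $C$, i.e. the set of all $f\in\mathcal{R}$ with $\sum_{a}f_a g_a=0$ for all $g\in C$ (standard dot product of coefficient vectors). *)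

(* Defs.v *)
From HB Require Import structures.
From mathcomp Require Import all_boot all_algebra.
From mathcomp Require Import generic_quotient ring_quotient.
From mathcomp Require Import boolp classical_sets.
From mathcomp Require Import bigenough ssrcomplements mpoly.

Set Implicit Arguments.
Unset Strict Implicit.
Unset Printing Implicit Defensive.

Import GRing.Theory BigEnough.

Local Open Scope ring_scope.
Local Open Scope quotient_scope.
Local Open Scope classical_set_scope.

Definition ideal_gen (R : comNzRingType) (I : finType) (G : I -> R) : set R :=
  [set f | exists h : I -> R, f = \sum_(i : I) h i * G i].

Definition principal_ideal (R : comNzRingType) (g : R) : set R :=
  ideal_gen (fun _ : unit => g).

Lemma principal_idealP (R : comNzRingType) (g f : R) :
  principal_ideal g f <-> exists h, f = h * g.
Proof.
split=> [[h ->]|[h ->]]; first by exists (h tt); rewrite (big_pred1 tt) // => -[].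
by exists (fun=> h); rewrite (big_pred1 tt) // => -[].
Qed.

Section QuotientRing.
Variables (F : fieldType) (n : nat) (m : 'I_n -> nat).
Implicit Types p q r : {mpoly F[n]}.

Definition relator (j : 'I_n) : {mpoly F[n]} := 'X_j ^+ m j - 1.

(* The library's quotient of a ring by an ideal wants the ideal as a boolean
   predicate. *)
Definition rel_ideal p : bool := `[< ideal_gen relator p >].

Lemma rel_ideal_closed : idealr_closed rel_ideal.
Proof.
split; rewrite ?unfold_in.
- by apply/asboolP; exists (fun=> 0); rewrite big1 // => i _; rewrite mul0r.
- apply/negP => /asboolP[h] /(congr1 (meval (fun=> 1))).
  rewrite rmorph1 rmorph_sum big1 => [/eqP|i _]; first by rewrite oner_eq0.
  by rewrite rmorphM rmorphB rmorphXn /= mevalXU rmorph1 expr1n subrr mulr0.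
- move=> a u v; rewrite !unfold_in => /asboolP[h ->] /asboolP[k ->].
  apply/asboolP; exists (fun i => a * h i + k i).
  rewrite mulr_sumr -big_split; apply: eq_bigr => i _ /=.
  by rewrite mulrDl mulrA.
Qed.

HB.instance Definition _ :=
  isIdealr.Build {mpoly F[n]} rel_ideal rel_ideal_closed.

Definition rel_idealr : idealr {mpoly F[n]} := rel_ideal.

(* F[x_1, ..., x_n] / <x_1 ^ m_1 - 1, ..., x_n ^ m_n - 1> *)
Definition mcirc : comNzRingType := {ideal_quot rel_idealr}.

Definition toR (p : {mpoly F[n]}) : mcirc := \pi_({ideal_quot rel_idealr}) p.

Lemma toR_is_zmod_morphism : zmod_morphism toR.
Proof. exact: (rmorphB (\pi_({ideal_quot rel_idealr}))). Qed.

Lemma toR_is_monoid_morphism : monoid_morphism toR.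
Proof.
by split; [exact: (rmorph1 (\pi_({ideal_quot rel_idealr})))
         | exact: (rmorphM (\pi_({ideal_quot rel_idealr})))].
Qed.

HB.instance Definition _ :=
  GRing.isZmodMorphism.Build {mpoly F[n]} mcirc toR toR_is_zmod_morphism.
HB.instance Definition _ :=
  GRing.isMonoidMorphism.Build {mpoly F[n]} mcirc toR toR_is_monoid_morphism.

Lemma toR_eqP p q : toR p = toR q <-> ideal_gen relator (p - q).
Proof.
split=> [/eqP|pq]; rewrite /toR.
- by rewrite -Quotient.idealrBE unfold_in => /asboolP.
- by apply/eqP; rewrite -Quotient.idealrBE unfold_in; apply/asboolP.
Qed.

Lemma toR_surj (f : mcirc) : exists p, toR p = f.
Proof. by exists (repr f); rewrite /toR reprK. Qed.

Definition varR (j : 'I_n) : mcirc := toR 'X_j.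

Lemma varR_expm j : varR j ^+ m j = 1.
Proof.
rewrite /varR -rmorphXn -(rmorph1 toR); apply/toR_eqP.
exists (fun i => (i == j)%:R); rewrite (bigD1 j) //= eqxx mul1r.
by rewrite big1 ?addr0 // => i /negPf->; rewrite mul0r.
Qed.

Definition reduced p : Prop :=
  forall a : 'X_{1..n}, a \in msupp p -> forall j, (a j < m j)%N.

Definition redm (a : 'X_{1..n}) : 'X_{1..n} := [multinom (a j %% m j)%N | j < n].

Definition red p : {mpoly F[n]} := \sum_(a <- msupp p) p@_a *: 'X_[redm a].

Lemma redwE p k : (msize p <= k)%N ->
  red p = \sum_(a : 'X_{1..n < k}) p@_a *: 'X_[redm a].
Proof.
pose I : subFinType _ := 'X_{1..n < k}.
move=> le_pk; rewrite /red (big_mksub I) /=; first last.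
- by move=> x /msize_mdeg_lt/leq_trans/(_ le_pk).
- by rewrite msupp_uniq.
by rewrite big_rmcond //= => j /memN_msupp_eq0 ->; rewrite scale0r.
Qed.

Lemma red_is_linear : linear red.
Proof.
move=> c p q; pose_big_enough k; first rewrite !(@redwE _ k) //.
  rewrite scaler_sumr -big_split /=; apply: eq_bigr => a _.
  by rewrite mcoeffD mcoeffZ scalerDl scalerA.
by close.
Qed.

HB.instance Definition _ :=
  GRing.isLinear.Build F {mpoly F[n]} {mpoly F[n]} _ red red_is_linear.

Lemma redZ c p : red (c *: p) = c *: red p.
Proof. exact: linearZ. Qed.

Lemma redX a : red 'X_[a] = 'X_[redm a].
Proof. by rewrite /red msuppX big_seq1 mcoeffX eqxx scale1r. Qed.

Lemma red_ideal p : ideal_gen relator p -> red p = 0.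
Proof.
case=> h ->; rewrite raddf_sum big1 // => j _.
rewrite (mpolyE (h j)) mulr_suml raddf_sum big1 // => a _.
rewrite -scalerAl /= /relator mulrBr mulr1.
rewrite redZ raddfB /= mpolyXn -mpolyXD.
rewrite !redX [X in 'X_[X] - _](_ : _ = redm a) ?subrr ?scaler0 //.
apply/mnmP => i; rewrite !mnmE mulmnE mnm1E.
by case: (eqVneq j i) => [->|_]; rewrite ?mul1n ?mul0n ?addn0 // modnDr.
Qed.

Lemma red_id p : reduced p -> red p = p.
Proof.
move=> rp; rewrite [RHS]mpolyE /red !big_seq; apply: eq_bigr => a /rp lt_am.
by congr (_ *: 'X_[_]); apply/mnmP => j; rewrite mnmE modn_small.
Qed.

Lemma toR_red p : toR (red p) = toR p.
Proof.
rewrite [in RHS](mpolyE p) /red !raddf_sum; apply: eq_bigr => a _ /=.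
rewrite -!mul_mpolyC !rmorphM; congr (_ * _).
rewrite !mpolyXE_id !rmorph_prod; apply: eq_bigr => j _.
rewrite !rmorphXn -/(varR j) mnmE {2}(divn_eq (a j) (m j)) exprD mulnC exprM.
by rewrite varR_expm expr1n mul1r.
Qed.

Lemma red_reduced p : (forall j, (0 < m j)%N) -> reduced (red p).
Proof.
move=> m_gt0 b; rewrite mcoeff_msupp => + j.
rewrite ltnNge; apply: contraNN => le_mb.
rewrite /red raddf_sum big1 //= => a _; rewrite mcoeffZ mcoeffX.
case: eqP => [ab|_]; last by rewrite mulr0.
by move: le_mb; rewrite -ab mnmE leqNgt ltn_pmod.
Qed.

(* The reduced representative of f; by rrep_spec and rrep_uniq it exists and is
   unique as soon as all m_j are positive. *)
Definition rrep (f : mcirc) : {mpoly F[n]} :=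
  xget 0 [set r | reduced r /\ toR r = f].

Lemma rrep_spec (f : mcirc) : (forall j, (0 < m j)%N) ->
  reduced (rrep f) /\ toR (rrep f) = f.
Proof.
move=> m_gt0; apply: (@xgetPex _ 0 [set r | reduced r /\ toR r = f]).
have [p <-] := toR_surj f; exists (red p).
by split; [exact: red_reduced | exact: toR_red].
Qed.

Lemma reduced_inj r1 r2 :
  reduced r1 -> reduced r2 -> toR r1 = toR r2 -> r1 = r2.
Proof.
move=> /red_id {2}<- /red_id {2}<- /toR_eqP/red_ideal/eqP.
by rewrite raddfB subr_eq0 => /eqP.
Qed.

Lemma rrep_uniq r : reduced r -> rrep (toR r) = r.
Proof.
by move=> rr; apply: xget_unique => // q [rq]; apply: reduced_inj.
Qed.

Definition coefR (f : mcirc) (a : {dffun forall j : 'I_n, 'I_(m j)}) : F :=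
  (rrep f)@_[multinom (a j : nat) | j < n].

Definition dotR (f g : mcirc) : F :=
  \sum_(a : {dffun forall j : 'I_n, 'I_(m j)}) coefR f a * coefR g a.

Definition dual (C : set mcirc) : set mcirc :=
  [set f | forall g, C g -> dotR f g = 0].

End QuotientRing.

Arguments varR : clear implicits.

(* Main.v *)
(** The dot product is invariant under multiplication by x_j, so multiplication
by x_j - 1 is adjoint to multiplication by x_j^-1 - 1 = - x_j^-1 (x_j - 1), a
unit multiple of x_j - 1. As the dot product is nondegenerate, the dual of
<g>, g = prod_j (x_j - 1)^N_j, is therefore the annihilator of g. Since
x_j^m_j - 1 = (x_j - 1)^m_j in characteristic p, lifting to polynomials and
substituting X_j + 1 for X_j reduces the computation of this annihilator to the
colon ideal <X_1^m_1, ..., X_n^m_n> : prod_j X_j^N_j of monomial ideals. *)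

Require Import Defs.
From mathcomp Require Import all_boot all_algebra.
From mathcomp Require Import classical_sets.
From mathcomp Require Import mpoly.

Set Implicit Arguments.
Unset Strict Implicit.
Unset Printing Implicit Defensive.

Import GRing.Theory.

Local Open Scope ring_scope.

(** * Finitely generated ideals *)

Lemma ideal_gen0 (R : comNzRingType) (I : finType) (G : I -> R) :
  ideal_gen G 0.
Proof. by exists (fun=> 0); rewrite big1 // => i _; rewrite mul0r. Qed.

Lemma ideal_genD (R : comNzRingType) (I : finType) (G : I -> R) f g :
  ideal_gen G f -> ideal_gen G g -> ideal_gen G (f + g).
Proof.
move=> [h ->] [k ->]; exists (fun i => h i + k i).
by rewrite -big_split; apply: eq_bigr => i _; rewrite mulrDl.
Qed.

Lemma ideal_gen_mul (R : comNzRingType) (I : finType) (G : I -> R) h i :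
  ideal_gen G (h * G i).
Proof.
exists (fun j => if j == i then h else 0); rewrite (bigD1 i) //= eqxx.
by rewrite big1 ?addr0 // => j /negPf->; rewrite mul0r.
Qed.

(** Serves for translations of the variables, for the projection to the quotient and, with the
    identity, for rewriting generators. *)
Lemma ideal_gen_rmorph (R S : comNzRingType) (phi : {rmorphism R -> S})
    (I : finType) (G : I -> R) (H : I -> S) f :
  (forall i, phi (G i) = H i) ->
  ideal_gen G f -> ideal_gen H (phi f).
Proof.
move=> GH [h ->]; exists (fun i => phi (h i)).
by rewrite rmorph_sum; apply: eq_bigr => i _; rewrite rmorphM GH.
Qed.

(** * Colon ideals: the monomial case and its translate *)

Section MonomialIdeals.
Variables (F : fieldType) (n : nat).
Implicit Types (P : {mpoly F[n]}) (m N : 'I_n -> nat).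

Lemma mcoeff_mulXU P (j : 'I_n) e (b : 'X_{1..n}) :
  (b j < e)%N -> (P * 'X_j ^+ e)@_b = 0.
Proof.
move=> lt_be; rewrite (mpolyE P) mulr_suml raddf_sum big1 // => a _ /=.
rewrite mpolyXn -scalerAl -mpolyXD mcoeffZ mcoeffX.
case: eqP => [ab|]; last by rewrite mulr0.
by move: lt_be; rewrite -ab mnmDE mulmnE mnm1E eqxx mul1n ltnNge leq_addl.
Qed.

(** Multiplication by a monomial only shifts the support, so the question can be settled one
    monomial of [P] at a time. *)
Lemma monomial_ideal_mulX m N P :
  (forall j, N j <= m j)%N ->
  ideal_gen (fun j : 'I_n => 'X_j ^+ m j) (P * \prod_(j < n) 'X_j ^+ N j) ->
  ideal_gen (fun j : 'I_n => 'X_j ^+ (m j - N j)) P.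
Proof.
move=> le_Nm [h hP].
pose b := [multinom N j | j < n].
have XN : \prod_(j < n) 'X_j ^+ N j = 'X_[b] :> {mpoly F[n]}.
  by rewrite [RHS]mpolyXE_id; apply: eq_bigr => j _; rewrite mnmE.
(* If a_j < m_j - N_j for all j, the coefficient of [P] at [a] is that of the product at [b + a],
   whose exponents all lie below m_j, so it vanishes. *)
have supp a : a \in msupp P -> exists j : 'I_n, (m j - N j <= a j)%N.
  move=> aP; apply/existsP; apply: contraLR aP => /existsPn lt_a.
  rewrite mcoeff_msupp negbK -(mcoeffMX P b a) -XN hP raddf_sum big1 //= => j _.
  apply: mcoeff_mulXU; rewrite mnmDE mnmE.
  by have := lt_a j; rewrite -ltnNge ltn_subRL.
rewrite (mpolyE P) big_seq; apply: big_ind.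
- exact: ideal_gen0.
- exact: ideal_genD.
- move=> a /supp[j le_a].
  have -> : 'X_[a] = 'X_[a - U_(j) *+ (m j - N j)] * 'X_j ^+ (m j - N j)
      :> {mpoly F[n]}.
    rewrite mpolyXn -mpolyXD submK //; apply/mnm_lepP => i.
    by rewrite mulmnE mnm1E; case: eqP => [<-|]; rewrite ?mul1n.
  by rewrite scalerAl; apply: (ideal_gen_mul (fun j => 'X_j ^+ (m j - N j))).
Qed.

Definition translate (c : F) : n.-tuple {mpoly F[n]} :=
  [tuple 'X_j + c%:MP | j < n].

Lemma translateX c (j : 'I_n) : 'X_j \mPo translate c = 'X_j + c%:MP.
Proof. by rewrite comp_mpolyXU -tnth_nth tnth_mktuple. Qed.

Lemma translateK c P : (P \mPo translate c) \mPo translate (- c) = P.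
Proof.
elim/mpolyind: P => [|k a P _ _ IH]; first by rewrite !comp_mpoly0.
rewrite !comp_mpolyD IH !comp_mpolyZ mpolyXE_id !rmorph_prod.
congr (_ *: _ + _); apply: eq_bigr => j _; rewrite !rmorphXn /=.
by rewrite translateX comp_mpolyD comp_mpolyC translateX mpolyCN addrNK.
Qed.

(** The substitution of X_j + 1 for X_j reduces this to monomials, and the inverse substitution
    brings the conclusion back. *)
Lemma linear_ideal_mul m N P :
  (forall j, N j <= m j)%N ->
  ideal_gen (fun j : 'I_n => ('X_j - 1) ^+ m j)
    (P * \prod_(j < n) ('X_j - 1) ^+ N j) ->
  ideal_gen (fun j : 'I_n => ('X_j - 1) ^+ (m j - N j)) P.
Proof.
move=> le_Nm idP; have subX e (j : 'I_n) :
    (('X_j - 1) ^+ e) \mPo translate 1 = 'X_j ^+ e.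
  by rewrite rmorphXn rmorphB rmorph1 /= translateX mpolyC1 addrK.
rewrite -(translateK 1 P).
apply: (ideal_gen_rmorph (phi := comp_mpoly (translate (- 1)))
          (G := fun j : 'I_n => 'X_j ^+ (m j - N j))) => [j|].
  by rewrite rmorphXn /= translateX mpolyCN mpolyC1.
apply: monomial_ideal_mulX => //.
rewrite (_ : \prod_(j < n) _ =
  (\prod_(j < n) ('X_j - 1) ^+ N j) \mPo translate 1); last first.
  by rewrite rmorph_prod; apply: eq_bigr => j _; rewrite /= subX.
rewrite -rmorphM; exact: (ideal_gen_rmorph (fun j => subX (m j) j) idP).
Qed.

End MonomialIdeals.

(** * The dot product of the quotient ring *)

Section DotProduct.
Variables (F : fieldType) (n : nat) (m : 'I_n -> nat).
Hypothesis m_gt0 : forall j, (0 < m j)%N.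
Local Notation R := (mcirc F m).
Implicit Types (P Q : {mpoly F[n]}) (f g h : R) (a b : 'X_{1..n}).
Local Notation tR := (toR m).
Local Notation dot := (@dotR F n m).
Local Notation rd := (@red F n m).

(** Replaces the chosen representative by the linear map [red], whence the bilinearity of the dot
    product. *)
Lemma rrep_toR P : rrep (tR P) = rd P.
Proof. by rewrite -toR_red rrep_uniq //; apply: red_reduced. Qed.

Lemma dotRC f h : dot f h = dot h f.
Proof. by apply: eq_bigr => a _; rewrite mulrC. Qed.

Lemma dotR_linearl c P Q h :
  dot (tR (c *: P + Q)) h = c * dot (tR P) h + dot (tR Q) h.
Proof.
rewrite /dotR mulr_sumr -big_split; apply: eq_bigr => a _ /=.
by rewrite /coefR !rrep_toR linearP mcoeffD mcoeffZ mulrDl mulrA.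
Qed.

Lemma dotR_linearr c P Q f :
  dot f (tR (c *: P + Q)) = c * dot f (tR P) + dot f (tR Q).
Proof. by rewrite dotRC dotR_linearl ![dot _ f]dotRC. Qed.

Lemma dotRBl f g h : dot (f - g) h = dot f h - dot g h.
Proof.
have [P <-] := toR_surj f; have [Q <-] := toR_surj g.
by rewrite -rmorphB addrC -scaleN1r dotR_linearl mulN1r addrC.
Qed.

Lemma dotR0l h : dot 0 h = 0.
Proof. by rewrite -(subrr 0) dotRBl subrr. Qed.

Lemma dotRBr f g h : dot f (g - h) = dot f g - dot f h.
Proof. by rewrite dotRC dotRBl ![dot _ f]dotRC. Qed.

(** A monomial reduces to a single monomial with coefficient 1, so only one term of the sum
    survives. *)
Lemma dotR_monomial P a : dot (tR P) (tR 'X_[a]) = (rd P)@_(redm m a).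
Proof.
pose d : {dffun forall j : 'I_n, 'I_(m j)} :=
  [ffun j => Ordinal (ltn_pmod (a j) (m_gt0 j))].
have dE : [multinom (d j : nat) | j < n] = redm m a.
  by apply/mnmP => j; rewrite !mnmE ffunE.
rewrite /dotR (bigD1 d) //= /coefR !rrep_toR redX dE mcoeffX eqxx mulr1.
rewrite big1 ?addr0 // => e neq_ed; rewrite mcoeffX -dE.
case: eqP => [de|]; last by rewrite mulr0.
case/eqP: neq_ed; apply/ffunP => j; apply/val_inj => /=.
by move/mnmP/(_ j): de; rewrite !mnmE.
Qed.

Lemma dotR_nondegenerate f : (forall h, dot f h = 0) -> f = 0.
Proof.
have [P <-] := toR_surj f => P_perp; rewrite -toR_red -[RHS](rmorph0 tR).
congr (tR _); apply/mpolyP => a; rewrite mcoeff0.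
have [/red_reduced lt_a|/memN_msupp_eq0 //] := boolP (a \in msupp (rd P)).
have {1}-> : a = redm m a.
  by apply/mnmP => j; rewrite mnmE modn_small // lt_a.
by rewrite -dotR_monomial P_perp.
Qed.

(** By bilinearity both arguments may be taken to be monomials. Their dot product is 1 or 0
    according to whether the exponents agree modulo every m_j, which adding [a] to both does not
    affect. *)
Lemma dotR_mulX a P Q :
  dot (tR ('X_[a] * P)) (tR ('X_[a] * Q)) = dot (tR P) (tR Q).
Proof.
have dot0r g : dot g (tR 0) = 0 by rewrite rmorph0 dotRC dotR0l.
elim/mpolyind: Q => [|k b Q _ _ IHQ]; first by rewrite mulr0 !dot0r.
rewrite mulrDr -scalerAr !dotR_linearr {}IHQ; congr (_ * _ + _).
elim/mpolyind: P => [|c d P _ _ IHP]; first by rewrite mulr0 !rmorph0 !dotR0l.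
rewrite mulrDr -scalerAr !dotR_linearl {}IHP; congr (_ * _ + _).
rewrite -!mpolyXD !dotR_monomial !redX !mcoeffX; congr (_ %:R); congr nat_of_bool.
apply/eqP/eqP => /mnmP eq_db; apply/mnmP => j;
  by have /eqP := eq_db j; rewrite !mnmE => eq_j; apply/eqP; move: eq_j;
  rewrite eqn_modDl.
Qed.

Lemma dotR_var j f h : dot (varR F n m j * f) (varR F n m j * h) = dot f h.
Proof.
have [P <-] := toR_surj f; have [Q <-] := toR_surj h.
by rewrite /varR -!rmorphM dotR_mulX.
Qed.

(** * Adjoints of multiplication operators, and the dual as an annihilator *)

Definition adjoint (u v : R) := forall f h, dot f (u * h) = dot (v * f) h.

Lemma adjoint1 : adjoint 1 1.
Proof. by move=> f h; rewrite !mul1r. Qed.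

Lemma adjointM u v u' v' :
  adjoint u v -> adjoint u' v' -> adjoint (u * u') (v * v').
Proof. by move=> uv uv' f h; rewrite -mulrA uv uv' mulrA [v' * _]mulrC. Qed.

Lemma adjointX u v k : adjoint u v -> adjoint (u ^+ k) (v ^+ k).
Proof.
move=> uv; elim: k => [|k IH]; first by rewrite !expr0; apply: adjoint1.
by rewrite !exprS; apply: adjointM.
Qed.

Lemma adjoint_prod (I : finType) (u v : I -> R) :
  (forall i, adjoint (u i) (v i)) -> adjoint (\prod_i u i) (\prod_i v i).
Proof.
move=> uv; elim/big_rec2: _ => [|i y x _ IH]; first exact: adjoint1.
exact: adjointM.
Qed.

Lemma var_expK j : varR F n m j * varR F n m j ^+ (m j).-1 = 1.
Proof. by rewrite -exprS prednK // varR_expm. Qed.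

Lemma adjoint_var_sub1 j :
  adjoint (varR F n m j - 1)
          (- varR F n m j ^+ (m j).-1 * (varR F n m j - 1)).
Proof.
move=> f h; rewrite mulrBl mul1r dotRBr.
(* Write f = x_j (x_j^(m_j - 1) f), so that invariance cancels x_j in the first product. *)
rewrite -[f in X in X - _]mul1r -[X in X * f](var_expK j) -mulrA dotR_var.
rewrite -dotRBl; congr (dot _ h).
by rewrite mulrBr mulr1 opprK mulNr [_ ^+ _ * varR _ _ _ _]mulrC var_expK
  [RHS]mulrDl mulN1r addrC.
Qed.

Lemma dual_principal (N : 'I_n -> nat) f :
  let g := \prod_(j < n) (varR F n m j - 1) ^+ N j in
  dual (principal_ideal g) f <-> f * g = 0.
Proof.
move=> g; pose y j := varR F n m j.
(* [U] collects the unit factors of the adjoints of the x_j - 1, and [V] is its inverse. *)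
pose U := \prod_(j < n) (- y j ^+ (m j).-1) ^+ N j.
pose V := \prod_(j < n) (- y j) ^+ N j.
have VU : V * U = 1.
  rewrite -big_split big1 //= => j _.
  by rewrite -exprMn mulrNN var_expK expr1n.
have adj_g : adjoint g (U * g).
  rewrite -big_split /=.
  rewrite (eq_bigr (fun j => (- y j ^+ (m j).-1 * (y j - 1)) ^+ N j)).
    by apply: adjoint_prod => j; apply/adjointX/adjoint_var_sub1.
  by move=> j _; rewrite exprMn.
split=> [f_perp | fg0 _ /principal_idealP[h ->]]; last first.
  by rewrite mulrC adj_g -mulrA [g * f]mulrC fg0 mulr0 dotR0l.
have Ugf0 : U * g * f = 0.
  apply: dotR_nondegenerate => h; rewrite -adj_g mulrC.
  by apply: f_perp; apply/principal_idealP; exists h.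
by rewrite mulrC -[g]mul1r -VU -!mulrA [U * _]mulrA Ugf0 mulr0.
Qed.

End DotProduct.

Theorem lemma3p6 (p : nat) (F : finFieldType) (n : nat) (s N : 'I_n -> nat)
  (p_prime : prime p) (charF : p \in [pchar F]) (n_ge1 : (1 <= n)%N)
  (s_gt0 : forall j, (0 < s j)%N) (N_le : forall j, (N j <= p ^ s j)%N) :
  let m := fun j : 'I_n => (p ^ s j)%N in
  let x := varR F n m in
  let C := principal_ideal (\prod_(j < n) (x j - 1) ^+ N j) in
  dual C = ideal_gen (fun j : 'I_n => (x j - 1) ^+ (m j - N j)).
Proof.
move=> m x C.
have m_gt0 j : (0 < m j)%N by rewrite expn_gt0 prime_gt0.
(* Writing X_j as (X_j - 1) + 1 before applying Frobenius avoids the sign (-1)^m_j. *)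
have relE j : relator F m j = ('X_j - 1) ^+ m j.
  have p_nat : [pchar {mpoly F[n]}].-nat (m j).
    have charM := rmorph_pchar (mpolyC n (R := F)) charF.
    by rewrite pnatX (pnatE _ p_prime) charM.
  rewrite /relator -[in LHS](subrK 1 'X_j) exprDn_pchar // expr1n.
  by rewrite addrK.
have toRy j e : toR m (('X_j - 1) ^+ e) = (x j - 1) ^+ e.
  by rewrite rmorphXn rmorphB rmorph1.
have y_nil j : (x j - 1) ^+ m j = 0.
  rewrite -toRy -relE -[RHS](rmorph0 (toR m)); apply/toR_eqP.
  by rewrite subr0 -[relator _ _ _]mul1r; apply: ideal_gen_mul.
apply/seteqP; split=> f.
(* Lift f to [P]: the product of [P] with the lifted generator lies in the ideal of relators, so the
   colon computation applies, and its conclusion is projected back. *)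
- move/(dual_principal m_gt0); have [P <-] := toR_surj f => Pg0.
  apply: (ideal_gen_rmorph (fun j => toRy j (m j - N j)%N)).
  apply: linear_ideal_mul => //.
  have : toR m (P * \prod_(j < n) ('X_j - 1) ^+ N j) = toR m 0.
    rewrite rmorph0 rmorphM rmorph_prod -[RHS]Pg0; congr (_ * _).
    by apply: eq_bigr => j _; rewrite /= toRy.
  move/toR_eqP; rewrite subr0; apply: (ideal_gen_rmorph (phi := idfun)) => j.
  exact: relE.
(* Each (x_j - 1)^(m_j - N_j) times the generator contains the factor (x_j - 1)^m_j = 0. *)
- case=> h ->; apply/dual_principal => //; rewrite mulr_suml big1 // => j _.
  by rewrite (bigD1 j) //= mulrA -[h j * _ * _]mulrA -exprD subnK // y_nil
    mulr0 mul0r.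
Qed.
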